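(* There is no orthogonal matrix of order $4$ which is a non-trivial linear combination of two distinct permutation matrices. That is, if $P\ne Q$ are $4\times4$ permutation matrices and $\alpha,\beta\in\mathbb{C}$ are both nonzero, then $\alpha P+\beta Q$ is not orthogonal.
   Context: A (complex) matrix $A$ is orthogonal if $A^TA=I$. A linear combination is non-trivial if all its coefficients are nonzero. *)

(* Defs.v *)
From mathcomp Require Import all_boot all_order all_algebra.

Set Implicit Arguments.
Unset Strict Implicit.
Unset Printing Implicit Defensive.

Import GRing.Theory.
Local Open Scope ring_scope.

(* Over the complex numbers this uses the plain transpose, not the conjugate
   transpose: orthogonal, not unitary. *)
Definition orthogonal_mx (F : comNzRingType) (n : nat) (A : 'M[F]_n) : Prop :=
  A^T *m A = 1%:M.

(* Main.v *)
(* For permutations p and q with p i <> q i, consider the entry at (p i, q i) of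
   A^T *m A, where A = alpha P + beta Q. It is off-diagonal, so alpha^2 P^T P and
   beta^2 Q^T Q do not contribute, while P^T Q contributes 1 and Q^T P
   contributes 0 or 1. The entry is thus alpha beta or 2 alpha beta, hence
   nonzero; the order 4 plays no role. *)
Require Import Defs.
From mathcomp Require Import all_boot all_order all_algebra.
From mathcomp Require Import fingroup perm.
From mathcomp Require Import reals complex.

Import GRing.Theory Num.Theory.
Local Open Scope ring_scope.
Local Open Scope complex_scope.

(** The product is the matrix of [p^-1 * q], which sends [p i] to [q i]. *)
Lemma tr_perm_mx_mul_perm_mxE (F : comNzRingType) (n : nat) (p q : 'S_n)
    (i j : 'I_n) :
  ((perm_mx p)^T *m perm_mx q : 'M[F]_n) (p i) j = (q i == j)%:R.
Proof. by rewrite tr_perm_mx -perm_mxM !mxE permM permK. Qed.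

(** Characteristic 2 must be excluded: there, for [n = 2], [p = 1] and [q] the transposition, any
    [alpha + beta = 1] gives an orthogonal matrix. *)
Lemma orthogonal_lin_comb_perm_mx (F : idomainType) (n : nat) (p q : 'S_n)
    (alpha beta : F) :
  (2%:R : F) != 0 -> p != q ->
  orthogonal_mx (alpha *: perm_mx p + beta *: perm_mx q) -> alpha * beta = 0.
Proof.
move=> two_neq0 neq_pq orthA.
have [i neq_i] : exists i, p i != q i.
  apply/existsP; apply: contraNT neq_pq; rewrite negb_exists => /forallP eq_pq.
  by apply/eqP/permP => i; apply/eqP; move: (eq_pq i); rewrite negbK.
have /matrixP/(_ (p i) (q i)) := orthA.
have -> : (alpha *: perm_mx p + beta *: perm_mx q)^T =
    alpha *: (perm_mx p)^T + beta *: (perm_mx q)^T.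
  by apply/matrixP => j k; rewrite !mxE.
rewrite mulmxDl !mulmxDr.
rewrite -!scalemxAl -!scalemxAr !scalerA.
have entryD (A B : 'M[F]_n) j k : (A + B) j k = A j k + B j k by rewrite mxE.
have entryZ a (A : 'M[F]_n) j k : (a *: A) j k = a * A j k by rewrite mxE.
rewrite !(entryD, entryZ) !tr_perm_mx_mul_perm_mxE.
(* The two products starting with the transpose of [perm_mx q] remain, as row [p i] is not given as
   a value of [q]. *)
rewrite !tr_perm_mx -!perm_mxM mulVg.
rewrite !mxE perm1 (negbTE neq_i) eqxx !mulr0 !mulr1 add0r addr0.
rewrite [beta * alpha]mulrC -[X in X + _]mulr1 -mulrDr.
move/eqP; rewrite mulf_eq0 => /orP[/eqP //|].
(* The boolean tells whether [q^-1 * p] sends [p i] to [q i]; the factor is 2 if so, else 1. *)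
by case: (_ == q i); [exact/contraTeq | rewrite addr0 oner_eq0].
Qed.

Theorem theorem3p4 (R : realType) (P Q : 'M[R[i]]_4) (alpha beta : R[i])
    (hP : is_perm_mx P) (hQ : is_perm_mx Q) (hPQ : P <> Q)
    (halpha : alpha <> 0) (hbeta : beta <> 0) :
  ~ orthogonal_mx (alpha *: P + beta *: Q).
Proof.
move: hP hQ hPQ => /is_perm_mxP[p ->] /is_perm_mxP[q ->] hPQ.
have neq_pq : p != q by apply/eqP => eq_pq; apply: hPQ; rewrite eq_pq.
have two_neq0 : (2%:R : R[i]) != 0 by rewrite pnatr_eq0.
move/(orthogonal_lin_comb_perm_mx _ _ _ _ _ _ two_neq0 neq_pq)/eqP.
by rewrite mulf_eq0 => /orP[] /eqP.
Qed.
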